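(* Assume $\diamondsuit$. Then there is a Countryman line which embeds into all of its uncountable suborders.
   Context: A Countryman line is an uncountable linear order $C$ such that $C\times C$ is the union of countably many chains with respect to the coordinatewise partial order. $\diamondsuit$ is Jensen's diamond principle on $\omega_1$. *)

(* Defs.v *)
From mathcomp Require Import all_boot all_order.
From mathcomp Require Import all_classical wochoice.

Set Implicit Arguments.
Unset Strict Implicit.
Unset Printing Implicit Defensive.

Local Open Scope classical_set_scope.
Local Open Scope order_scope.

(* [W] has order type omega_1: it is an uncountable well-order all of whose
   proper initial segments are countable. *)
Definition is_omega1 (d : Order.disp_t) (W : orderType d) : Prop :=
  [/\ well_order (<=%O : rel W),
      ~ countable [set: W]
    & forall a : W, countable [set b : W | b < a]].

Definition is_unbounded (d : Order.disp_t) (W : orderType d) (E : set W) :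
    Prop :=
  forall a : W, exists2 b : W, a < b & E b.

(* [a] is a limit of elements of [E], i.e. [a] is not the least element and
   [E] is cofinal below [a]; as [c < a] is strict, [a] is then a limit. *)
Definition is_limit_of (d : Order.disp_t) (W : orderType d) (E : set W)
    (a : W) : Prop :=
  (exists b : W, b < a) /\
  (forall b : W, b < a -> exists2 c : W, b < c < a & E c).

Definition is_club (d : Order.disp_t) (W : orderType d) (E : set W) : Prop :=
  is_unbounded E /\ (forall a : W, is_limit_of E a -> E a).

Definition is_stationary (d : Order.disp_t) (W : orderType d) (A : set W) :
    Prop :=
  forall E : set W, is_club E -> A `&` E !=set0.

(* Jensen's diamond, meaningful when [W] has order type omega_1: the ordinal
   [a] is identified with the set of its predecessors. *)
Definition diamond (d : Order.disp_t) (W : orderType d) : Prop :=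
  exists S : W -> set W,
    (forall a : W, S a `<=` [set b : W | b < a]) /\
    (forall X : set W,
       is_stationary [set a : W | X `&` [set b : W | b < a] = S a]).

(* The order on [C *p C] is the coordinatewise one. *)
Definition is_countryman (d : Order.disp_t) (C : orderType d) : Prop :=
  ~ countable [set: C] /\
  exists F : nat -> set (C *p C),
    (forall n : nat, total_on (F n) (fun p q : C *p C => p <= q)) /\
    \bigcup_n F n = [set: C *p C].

Definition embeds_into_suborder (d : Order.disp_t) (C : orderType d)
    (A : set C) : Prop :=
  exists f : C -> C, (forall x : C, A (f x)) /\ {mono f : x y / x <= y}.

(* Main.v *)
Require Import Defs.
From HB Require Import structures.
From mathcomp Require Import all_boot all_order all_algebra.
From mathcomp Require Import all_classical wochoice.
From mathcomp Require Import lra.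

(* A node of level [a] is a function that is a positive rational at each
   [i < a] and [0] from [a] on.  Build [e a] of level [a], each taking values
   below [n] only finitely often for every [n], and coherent: [e a] and [e b]
   differ finitely often below [min a b].  The line is the tree T of all finite
   modifications of the [e a], ordered lexicographically.

   Countryman: given [(s, t)] in T x T, let [m] be the first zero of [s] or [t]
   and [n] a bound for the finitely many values at which they differ up to [m].
   The values of [(s, t)] at the finitely many [i <= m] where one of them is
   below [n], listed in increasing order of [i], form a colour such that each
   colour class is a chain.

   Minimality: diamond guesses a set B of nodes below [a]; at a limit [a] where
   every node [t] of level [b < a] and every [n] admit an extension of [t] in B
   with all new values at least [n], a generic choice of [e a] forces every node
   of level [a] to have a truncation in B.  Taking for B the nodes without
   extension in an uncountable A, it follows that for some [t] and [n] all
   extensions of [t] with new values at least [n] are truncations of elements of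
   A.  The whole of T embeds among these: the part of a node up to the level of
   [t] is coded by a single rational, and above it an order embedding of
   [0, +oo) into [n, +oo) that is the identity from [n + 1] on alters each node
   only finitely often. *)

Set Implicit Arguments.
Unset Strict Implicit.
Unset Printing Implicit Defensive.

Import Order.TTheory GRing.Theory Num.Theory.
Local Open Scope classical_set_scope.
Local Open Scope ring_scope.
Local Open Scope order_scope.

(** * Well-founded recursion and maps into the rationals *)

(** The value at [a] is a chosen witness for the earlier values, filled up with [x0] elsewhere; the
    last hypothesis makes this filling harmless. *)
Lemma wf_choice (T X : Type) (x0 : X) (r : T -> T -> Prop)
    (R : T -> (T -> X) -> X -> Prop) :
  well_founded r ->
  (forall a h, exists x, R a h x) ->
  (forall a h h' x, (forall b, r b a -> h b = h' b) -> R a h x -> R a h' x) ->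
  exists h, forall a, R a h (h a).
Proof.
move=> rwf Rex Rloc.
have [F FP] : {F : T -> (T -> X) -> X | forall a h, R a h (F a h)}.
  exists (fun a h => sval (cid (Rex a h))) => a h.
  by case: cid.
pose restr a (rec : forall b, r b a -> X) b :=
  if pselect (r b a) is left rba then rec b rba else x0.
pose h := Fix rwf (fun=> X) (fun a rec => F a (restr a rec)).
have hE a : h a = F a (restr a (fun b _ => h b)).
  rewrite /h Fix_eq// => b f g fg; congr (F b (restr b _)).
  by apply: functional_extensionality_dep => c; apply: funext => rcb.
exists h => a; rewrite hE; apply: Rloc (FP _ _) => b rba.
by rewrite /restr; case: pselect.
Qed.

Lemma seq_max (d : Order.disp_t) (T : orderType d) (x : T) (s : seq T) :
  x \in s -> exists2 m, m \in s & forall y, y \in s -> y <= m.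
Proof.
elim: s x => // y [|z s] IH x.
  by move=> _; exists y; rewrite ?mem_head// => w; rewrite inE => /eqP ->.
move=> _; have [m ms mM] := IH z (mem_head _ _).
case: (leP y m) => ym.
  exists m; first by rewrite inE ms orbT.
  by move=> w; rewrite inE => /orP[/eqP ->//|/mM].
exists y; first by rewrite mem_head.
by move=> w; rewrite inE => /orP[/eqP ->//|/mM wm]; apply: le_trans wm (ltW ym).
Qed.

Lemma rat_between (s1 s2 : seq rat) (a b : rat) : a \in s1 -> b \in s2 ->
  (forall l u, l \in s1 -> u \in s2 -> l < u) ->
  exists x, (forall l, l \in s1 -> l < x) /\ (forall u, u \in s2 -> x < u).
Proof.
move=> /seq_max[l ls lM].
move=> /(@seq_max _ (rat^d)%type)[u us uM] lu.
have {}lu := lu _ _ ls us.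
exists ((l + u) / 2); split=> [x /lM xl|x /uM].
  by lra.
by rewrite leEdual => ux; lra.
Qed.

(** The values are chosen one by one: [q m] goes strictly between those already given to
    predecessors and to successors of [m]. Transitivity keeps the former below the latter. *)
Lemma partial_order_rat (R : nat -> nat -> Prop) (lo hi : rat) : lo < hi ->
  (forall k, ~ R k k) -> (forall k l m, R k l -> R l m -> R k m) ->
  exists q : nat -> rat, (forall k, lo < q k < hi) /\
    forall k m, R k m -> q k < q m.
Proof.
move=> lohi Rirr Rtr.
pose good (m : nat) (q : nat -> rat) := forall k, (k < m)%N ->
  lo < q k < hi /\ forall l, (l < m)%N -> R k l -> q k < q l.
pose step m q x := good m q -> lo < x < hi /\
  forall k, (k < m)%N -> (R k m -> q k < x) /\ (R m k -> x < q k).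
have [|||q qP] := @wf_choice nat rat 0 (fun k m => (k < m)%N) step.
- by elim/ltn_ind => m IH; constructor => k /IH.
- move=> m q; case: (pselect (good m q)) => [gmq|]; last by exists 0.
  pose s1 := lo :: [seq q k | k <- iota 0 m & `[< R k m >]].
  pose s2 := hi :: [seq q k | k <- iota 0 m & `[< R m k >]].
  have [|x [x1 x2]] := @rat_between s1 s2 lo hi (mem_head _ _) (mem_head _ _).
    move=> l u; rewrite !inE => /orP[/eqP->|/mapP[k + ->]].
      move=> /orP[/eqP->//|/mapP[k + ->]].
      by rewrite mem_filter mem_iota /= => /andP[_ /gmq[/andP[]]].
    rewrite mem_filter mem_iota /= => /andP[/asboolP Rkm km].
    move=> /orP[/eqP->//|/mapP[j + ->]].
      by have [/andP[]] := gmq _ km.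
    rewrite mem_filter mem_iota /= => /andP[/asboolP Rmj jm].
    by have [_] := gmq _ km; apply=> //; apply: Rtr Rmj.
  exists x => _; split.
    by rewrite x1 ?mem_head// x2 ?mem_head.
  move=> k km; split=> Rkm; [apply: x1|apply: x2].
    rewrite inE; apply/orP; right; apply: map_f.
    rewrite mem_filter mem_iota add0n km !andbT; apply/asboolP; exact: Rkm.
  rewrite inE; apply/orP; right; apply: map_f.
  rewrite mem_filter mem_iota add0n km !andbT; apply/asboolP; exact: Rkm.
- move=> m q q' x qq' qx gmq'.
  have /qx[? H] : good m q.
    move=> k km; have [] := gmq' k km; rewrite qq'// => ? H; split=> // l lm.
    by rewrite qq'//; exact: H.
  by split=> // k km; rewrite -qq'//; exact: H.
have gq m : good m q.
  elim: m => // m gm k; rewrite ltnS leq_eqVlt => /orP[/eqP->|km].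
    have [? H] := qP m gm; split=> // l.
    rewrite ltnS leq_eqVlt => /orP[/eqP-> /Rirr//|/H[_]]; exact.
  have [? H] := gm k km; split=> // l.
  rewrite ltnS leq_eqVlt => /orP[/eqP->|/H//].
  by have [_ /(_ k km)[]] := qP m gm.
exists q; split=> [k|k m Rkm]; first by have [] := gq k.+1 k (ltnSn _).
have [|_] := gq (maxn k m).+1 k; first by rewrite ltnS leq_maxl.
by apply=> //; rewrite ltnS leq_maxr.
Qed.

(** * Successors and bounds in order type omega_1 *)

Section Omega1.
Context (d : Order.disp_t) (W : orderType d) (hW : is_omega1 W).

Lemma omega1_least (P : set W) : P !=set0 ->
  exists2 z, P z & forall y, P y -> z <= y.
Proof.
move=> [x Px]; have [wo _ _] := hW.
have [|z [[zP zl] _]] := wo [pred x | `[< P x >]].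
  by exists x; apply/asboolP.
exists z; first exact/asboolP.
by move=> y Py; apply: zl; apply/asboolP.
Qed.

Lemma omega1_wf : well_founded (fun x y : W => x < y).
Proof.
move=> x; apply: contrapT => nx.
have [z nz zl] := @omega1_least [set x | ~ Acc (fun x y : W => x < y) x]
  (ex_intro _ x nx).
apply: nz; constructor=> y yz; apply: contrapT => /zl.
by rewrite leNgt yz.
Qed.

Lemma countable_below (a : W) : countable [set b | b < a].
Proof. by have [_ _] := hW; exact. Qed.

(** Without a bound, [W] would be a countable union of closed initial segments, each countable. *)
Lemma countable_bound (Y : set W) : countable Y -> exists w, forall y, Y y -> y < w.
Proof.
move=> cY; apply: contrapT => /forallNP nY.
have [_ ucW _] := hW; apply: ucW.
apply: (@sub_countable _ _ _ (\bigcup_(y in Y) ([set b | b < y] `|` [set y]))).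
  apply: subset_card_le => w _.
  have /existsNP[y /not_implyP[Yy /negP]] := nY w.
  rewrite -leNgt le_eqVlt => /orP[/eqP ->|wy]; exists y => //; first by right.
  by left.
apply: bigcup_countable => // y _.
have -> : [set b | b < y] `|` [set y] =
    \bigcup_(b in [set: bool]) (if b then [set b | b < y] else [set y]).
  rewrite eqEsubset; split=> x.
    by case=> ?; [exists true|exists false].
  by case=> -[] _ /= ?; [left|right].
apply: bigcup_countable => [//|[] _]; first exact: countable_below.
exact: countable1.
Qed.

Lemma omega1_succ (w : W) : exists s, forall x, (x < s) = (x <= w).
Proof.
have [v vP] := countable_bound (countable1 w).
have [s ws sl] := @omega1_least [set s | w < s] (ex_intro _ v (vP w erefl)).
exists s => x; apply/idP/idP => [xs|xw]; last exact: le_lt_trans ws.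
by rewrite leNgt; apply/negP => /sl; rewrite leNgt xs.
Qed.

Lemma omega1_bound2 (a b : W) : exists w, a < w /\ b < w.
Proof.
have [s sP] := omega1_succ (Order.max a b).
by exists s; rewrite !sP !le_max !lexx orbT.
Qed.

End Omega1.

(** * Nodes and their finite modifications *)

Section Nodes.
Context (d : Order.disp_t) (W : orderType d).
Implicit Types (a b c : W) (f g t u x : W -> rat) (e : W -> W -> rat).

Definition level b f := forall i, if i < b then is_true (0 < f i) else f i = 0.

Definition differ b f g : set W := [set i | i < b /\ f i <> g i].

Definition small b f (n : nat) : set W := [set i | i < b /\ f i < n%:R].

Definition node x b f := level b f /\ finite_set (differ b f x).

Definition graft b f g : W -> rat := fun i => if i < b then f i else g i.

Definition truncate b f := graft b f (fun=> 0).

Definition extends (n : nat) b t c u :=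
  (forall i, i < b -> u i = t i) /\ (forall i, b <= i -> i < c -> n%:R <= u i).

(** The conditions on a candidate [x] for [e a]. They involve [e] only below [a], so that [e] can be
    built by recursion. *)
Definition good e x a := [/\ level a x, forall n, finite_set (small a x n)
  & forall b, b < a -> finite_set (differ b x (e b))].

Lemma level_gt0 b f i : level b f -> i < b -> 0 < f i.
Proof. by move=> /(_ i); case: ifP. Qed.

Lemma level_eq0 b f i : level b f -> b <= i -> f i = 0.
Proof. by move=> /(_ i); rewrite leNgt; case: ifP. Qed.

Lemma level_ge0 b f i : level b f -> 0 <= f i.
Proof. by move=> /(_ i); case: ifP => _ => [/ltW|->]. Qed.

Lemma level_ltE b f i : level b f -> (0 < f i) = (i < b).
Proof. by move=> /(_ i); case: ifP => // _ ->; rewrite ltxx. Qed.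

Lemma level_graft b c f g : b <= c -> level b f -> level c g ->
  level c (graft b f g).
Proof.
move=> bc bf cg i; rewrite /graft; case: (ltP i b) => ib.
  by rewrite (lt_le_trans ib bc) (level_gt0 bf).
exact: cg.
Qed.

Lemma level_truncate b c f : b <= c -> level c f -> level b (truncate b f).
Proof.
move=> bc cf i; rewrite /truncate /graft; case: (ltP i b) => // ib.
by rewrite (level_gt0 cf) // (lt_le_trans ib).
Qed.

Lemma truncate_truncate b c f : b <= c -> truncate b (truncate c f) = truncate b f.
Proof.
move=> bc; apply: funext => i; rewrite /truncate /graft.
by case: (ltP i b) => // ib; rewrite (lt_le_trans ib bc).
Qed.

Lemma finite_sub2 (A B C : set W) : A `<=` B `|` C -> finite_set B ->
  finite_set C -> finite_set A.
Proof. by move=> /sub_finite_set + fB fC; apply; rewrite finite_setU. Qed.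

Lemma differ_tri c f g h : differ c f h `<=` differ c f g `|` differ c g h.
Proof.
move=> i [ic fh]; have [fg|fg] := eqVneq (f i) (g i).
  by right; split=> //; rewrite -fg.
by left; split=> //; exact/eqP.
Qed.

Lemma differ_le b c f g : b <= c -> differ b f g `<=` differ c f g.
Proof. by move=> bc i [ib ?]; split=> //; exact: lt_le_trans bc. Qed.

Lemma differC c f g : differ c f g = differ c g f.
Proof. by rewrite eqEsubset; split=> i [? h]; split=> // ?; apply: h. Qed.

Lemma differ_truncate b f g : differ b (truncate b f) g = differ b f g.
Proof.
by rewrite eqEsubset /differ /truncate /graft; split=> i /= [ib]; rewrite ib.
Qed.

Lemma good_differ e b c : b <= c -> good e (e c) c ->
  finite_set (differ b (e c) (e b)).
Proof.
rewrite le_eqVlt => /orP[/eqP -> _|bc [_ _ /(_ b bc)] //].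
by apply: sub_finite_set (finite_set0 _) => i [_].
Qed.

Lemma node_self e b : good e (e b) b -> node (e b) b (e b).
Proof. by move=> eb; split; [have [] := eb | exact: good_differ eb]. Qed.

Lemma node_truncate e b c f : b <= c -> good e (e c) c -> node (e c) c f ->
  node (e b) b (truncate b f).
Proof.
move=> bc ec [cf fin]; split; first exact: level_truncate bc cf.
rewrite differ_truncate; apply: finite_sub2 (@differ_tri _ _ (e c) _) _ _.
  exact: sub_finite_set (differ_le bc) fin.
exact: good_differ.
Qed.

Lemma node_small e c f n : good e (e c) c -> node (e c) c f ->
  finite_set (small c f n).
Proof.
move=> [_ /(_ n) sm _] [_ df]; apply: finite_sub2 _ df sm => i [ic fi].
have [E|N] := eqVneq (f i) (e c i); last by left; split=> //; exact/eqP.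
by right; split=> //; rewrite -E.
Qed.

Lemma node_differ e b c f g : b <= c -> good e (e c) c -> node (e b) b f ->
  node (e c) c g -> finite_set (differ b f g).
Proof.
move=> bc ec [_ bf] [_ cg]; apply: finite_sub2 (@differ_tri _ _ (e b) _) bf _.
rewrite differC; apply: finite_sub2 (@differ_tri _ _ (e c) _) _ _.
  exact: sub_finite_set (differ_le bc) cg.
exact: good_differ.
Qed.

Lemma node_graft e b c f g : b <= c -> good e (e c) c -> node (e b) b f ->
  node (e c) c g -> node (e c) c (graft b f g).
Proof.
move=> bc ec bf cg; split; first by apply: level_graft bc _ _; [case: bf|case: cg].
apply: finite_sub2 _ (node_differ bc ec bf cg) (proj2 cg) => i [ic].
rewrite /graft; case: (ltP i b) => ib fe; last by right.
have [E|N] := eqVneq (f i) (g i); last by left; split=> //; exact/eqP.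
by right; split=> //; rewrite -E.
Qed.

(** From [b] on, the maximum of [e c] and [n] serves: it alters [e c] only at the finitely many
    places where [e c] is below [n]. *)
Lemma node_extend e b c t n : b <= c -> good e (e c) c -> node (e b) b t ->
  exists2 u, node (e c) c u & extends n b t c u.
Proof.
move=> bc ec bt.
pose m : W -> rat := fun i => if i < c then Num.max (e c i) n%:R else 0.
have mc : node (e c) c m.
  split=> [i|].
    rewrite /m; have [ic|//] := ltP i c; rewrite lt_max (level_gt0 _ ic)//.
    by case: ec.
  have [_ /(_ n) + _] := ec; apply: sub_finite_set => i [ic].
  rewrite /m ic; move=> h; split=> //; rewrite ltNge; apply/negP => ni.
  by apply: h; exact/max_idPl.
exists (graft b t m); first exact: node_graft.
split=> i ib; first by rewrite /graft ib.
by move=> ic; rewrite /graft ltNge ib /= /m ic le_max lexx orbT.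
Qed.

Hypothesis hW : is_omega1 W.

(** A node is recovered from [x] and the finite list of its values where it differs from [x], the
    places being named by natural numbers; [F] decodes such a list. *)
Lemma countable_node x b : countable [set f | node x b f].
Proof.
have /countable_injP[r rinj] := countable_below hW b.
pose F (l : seq (nat * rat)) : W -> rat := fun i => if i < b then
  if has (fun p => p.1 == r i) l then (nth (0%N, 0) l (find (fun p => p.1 == r i) l)).2
  else x i else 0.
apply: (@sub_countable _ _ _ (F @` [set: seq (nat * rat)])); last first.
  by apply: sub_countable (card_image_le _ _) (countableP _).
apply: subset_card_le => f [bf /finite_seqP[s sE]].
exists [seq (r i, f i) | i <- s] => //; apply: funext => i; rewrite /F.
case: (ltP i b) => ib; last by rewrite (level_eq0 bf).
rewrite has_map find_map; set P := preim _ _.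
have PE j : j \in s -> P j -> j = i.
  move=> js /eqP /rinj; apply; rewrite inE//=.
  by have : [set` s] j by []; rewrite -sE => -[].
case: ifPn => [hs|hs].
  rewrite (nth_map i) -?has_find//=; congr f; apply: PE (nth_find _ hs).
  by rewrite mem_nth// -has_find.
apply/esym/eqP; apply: contraNT hs => /eqP fx; apply/hasP; exists i.
  by have : differ b f x i by []; rewrite sE.
exact: eqxx.
Qed.

End Nodes.

(** * Generic choice at limit levels *)

Section Limit.
Context (d : Order.disp_t) (W : orderType d) (hW : is_omega1 W).
Implicit Types (a b c : W) (f g t u x : W -> rat) (e : W -> W -> rat)
  (D : set W) (G : W -> (W -> rat) -> Prop).

(* Not topological density: [G] contains, above every node of level in [D], an
   extension whose new values are all at least any prescribed [n]. *)
Definition dense D e G := forall b t n, D b -> node (e b) b t ->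
  exists c u, [/\ b <= c, D c, node (e c) c u, G c u & extends n b t c u].

Definition branches_meet D x a G := forall f, node x a f ->
  exists2 c, D c & G c (truncate c f).

Lemma countable_enum (T : Type) (N : set T) (x0 : T) : N x0 -> countable N ->
  exists E : nat -> T, (forall k, N (E k)) /\ forall y, N y -> exists k, E k = y.
Proof.
move=> Nx0 /countable_injP[r rinj].
have Eex k : exists y, N y /\ ((exists2 x, N x & r x = k) -> r y = k).
  have [[x Nx xk]|no] := pselect (exists2 x, N x & r x = k).
    by exists x; split.
  by exists x0; split=> // /no.
have [E EP] := choice Eex; exists E; split=> [k|x Nx]; first by have [] := EP k.
exists (r x); have [NE rE] := EP (r x).
by apply: rinj; rewrite ?inE//; apply: rE; exists x.
Qed.

Lemma finite_bounded a (S : set W) : (exists b, b < a) ->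
  (forall b, b < a -> exists2 c, b < c & c < a) ->
  finite_set S -> (forall i, S i -> i < a) ->
  exists2 b, b < a & forall i, S i -> i < b.
Proof.
move=> [b0 b0a] lim /finite_seqP[s ->]; elim: s => [|i s IH] sa.
  by exists b0.
have [|b ba sb] := IH; first by move=> j js; apply: sa; rewrite /= inE; apply/orP; right.
have [c ic ca] : exists2 c, i < c & c < a.
  by apply: lim; apply: sa; rewrite /= inE eqxx.
exists (Order.max b c) => [|j]; first by rewrite gt_max ba ca.
rewrite /= inE lt_max => /orP[/eqP->|/sb ->//]; by rewrite ic orbT.
Qed.

Section Generic.
Variables (a : W) (e : W -> W -> rat) (G : W -> (W -> rat) -> Prop).
Hypotheses (a_pos : exists b, b < a)
  (a_lim : forall b, b < a -> exists2 c, b < c & c < a)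
  (e_good : forall b, b < a -> good e (e b) b).

Let below : set (W * (W -> rat)) := [set p | p.1 < a /\ node (e p.1) p.1 p.2].

Let countable_below_nodes : countable below.
Proof.
apply: (@sub_countable _ _ _ ([set b | b < a] `*`` (fun b => [set f | node (e b) b f]))).
  exact: subset_card_le.
by apply: countableXR => [|b _]; [exact: countable_below|exact: countable_node].
Qed.

(* The node [p] stands for the modifications of the limit that start with
   [p.2]; each of them must enter [G]. *)
Let next (p : W * (W -> rat)) (k : nat) (s s' : W * (W -> rat)) :=
  [/\ below s', s.1 <= s'.1, extends k s.1 s.2 s'.1 s'.2, p.1 <= s'.1 &
    dense [set b | b < a] e G -> G s'.1 (graft p.1 p.2 s'.2)].

(** First [s] is extended to at least the level of [p]; then its start is replaced by [p.2], density
    brings the result into [G], and the start is put back. Both extensions have new values at least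
    [k]. *)
Let next_ex p k s : below p -> below s -> exists s', next p k s s'.
Proof.
case: p s => [b t] [c0 s] [/= ba bt] [/= c0a c0s].
pose c1 := Order.max c0 b.
have c1a : c1 < a by rewrite gt_max c0a.
have c01 : c0 <= c1 by rewrite le_max lexx.
have bc1 : b <= c1 by rewrite le_max lexx orbT.
have [s1 s1P [s1s s1k]] := node_extend k c01 (e_good c1a) c0s.
have [de|nde] := pselect (dense [set b | b < a] e G); last first.
  by exists (c1, s1); split.
have [c [u [c1c ca cu Gu [ut uk]]]] :=
  de c1 _ k c1a (node_graft bc1 (e_good c1a) bt s1P).
exists (c, graft c1 s1 u); split=> /=.
- by split=> //; exact: node_graft (e_good _) _ _.
- exact: le_trans c1c.
- split=> i ic; first by rewrite /graft (lt_le_trans ic c01) s1s.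
  by move=> ic'; rewrite /graft; case: ltP => ic1; [exact: s1k|exact: uk].
- exact: le_trans c1c.
- move=> _; suff -> : graft b t (graft c1 s1 u) = u by [].
  apply: funext => i; move: (ut i); rewrite /graft; case: (ltP i b) => ib.
    by rewrite (lt_le_trans ib bc1) => ->.
  by case: (ltP i c1) => // _ ->.
Qed.

(** Stage [k] applies [next] to the [k]-th node [E k] in a list of all nodes of level below [a], and
    [x] is the union of the stages. A finite modification of [x] agrees with [x] from some [b < a]
    on; its part below [b] is some [E k], so stage [k] puts one of its truncations in [G]. *)
Lemma generic_limit : exists x, good e x a /\
  (dense [set b | b < a] e G -> branches_meet [set b | b < a] x a G).
Proof.
have [b0 b0a] := a_pos.
have below_e b : b < a -> below (b, e b).
  by move=> ba; split=> //=; exact/node_self/e_good.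
have [E [EN Esurj]] := countable_enum (below_e _ b0a) countable_below_nodes.
have [F FP] : exists F : nat -> W * (W -> rat) -> W * (W -> rat),
    forall k s, below s -> next (E k) k s (F k s).
  have H (ks : nat * (W * (W -> rat))) : exists s', below ks.2 -> next (E ks.1) ks.1 ks.2 s'.
    case: (pselect (below ks.2)) => [bs|nb]; last by exists ks.2.
    by have [s' ?] := next_ex ks.1 (EN ks.1) bs; exists s'.
  by have [F FP] := choice H; exists (fun k s => F (k, s)) => k s; exact: (FP (k, s)).
pose s := fix s k := if k is k'.+1 then F k' (s k') else (b0, e b0).
have sN k : below (s k).
  by elim: k => [|k /FP -/(_ k)[]//]; exact: below_e.
have sP k : next (E k) k (s k) (s k.+1) := FP k _ (sN k).
have sle j k : (j <= k)%N -> (s j).1 <= (s k).1.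
  elim: k => [|k IH]; first by rewrite leqn0 => /eqP ->.
  rewrite leq_eqVlt => /orP[/eqP->//|]; rewrite ltnS => /IH jk.
  by have [_ + _ _ _] := sP k; exact: le_trans.
have sext j k : (j <= k)%N -> forall i, i < (s j).1 -> (s k).2 i = (s j).2 i.
  elim: k => [|k IH]; first by rewrite leqn0 => /eqP ->.
  rewrite leq_eqVlt => /orP[/eqP->//|]; rewrite ltnS => jk i ij.
  have [_ _ [sk _] _ _] := sP k; rewrite sk; first exact: IH.
  exact: lt_le_trans (sle _ _ jk).
pose ub i k := i < (s k).1.
(* Each [e b] is itself listed, so the stages reach every level [b < a]. *)
have ubex i : i < a -> exists k, ub i k.
  move=> ia; have [b ib ba] := a_lim ia.
  have [k kE] := Esurj _ (below_e _ ba).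
  by exists k.+1; rewrite /ub; have [_ _ _ + _] := sP k; rewrite kE; exact: lt_le_trans.
pose x i := if pselect (exists k, ub i k) is left ex then (s (projT1 (cid ex))).2 i else 0.
have xE k i : i < (s k).1 -> x i = (s k).2 i.
  move=> ik; rewrite /x; case: pselect => [ex|[]]; last by exists k.
  case: cid => j /= ij; have [jk|/ltnW kj] := leqP j k.
    by rewrite (sext _ _ jk).
  by rewrite (sext _ _ kj).
have xa : level a x.
  move=> i; case: ltP => [/ubex[k ik]|ai].
    by rewrite (xE k)//; have [_ [/level_gt0 + _]] := sN k; apply.
  rewrite /x; case: pselect => // -[k ik]; have [ka _] := sN k.
  by have := lt_trans ik ka; rewrite ltNge ai.
have xcoh b : b < a -> finite_set (differ b x (e b)).
  move=> ba; have [k kE] := Esurj _ (below_e _ ba).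
  have bk : b <= (s k.+1).1 by have [_ _ _ + _] := sP k; rewrite kE.
  have [ka [_ fin]] := sN k.+1.
  apply: finite_sub2 (@differ_tri _ _ _ _ (e (s k.+1).1) _) _ _; last first.
    exact: good_differ bk (e_good ka).
  apply: sub_finite_set fin => i [ib]; rewrite (xE k.+1) => [h|].
    by split=> //; exact: lt_le_trans bk.
  exact: lt_le_trans bk.
have xsmall n : finite_set (small a x n).
  have [na nn] := sN n.
  apply: sub_finite_set (node_small n (e_good na) nn) => i [ia xn].
  (* A stage [k >= n] only adds values at least [k], so the values below [n] all occur below the
     level of [s n]. *)
  have small_s k : i < (s k).1 -> i < (s n).1.
    elim: k => [i0|k IH ik]; first exact: lt_le_trans (sle _ _ (leq0n n)).
    have [kn|nk] := ltnP k n; first exact: lt_le_trans (sle _ _ kn).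
    have [|ki] := ltP i (s k).1; first exact: IH.
    have [_ _ [_ /(_ i ki ik) h] _ _] := sP k.
    have kn : (n%:R : rat) <= k%:R by rewrite ler_nat.
    by have := le_trans kn h; rewrite -(xE k.+1)// leNgt xn.
  have [k ik] := ubex i ia; have iN := small_s _ ik.
  by split=> //; rewrite -(xE n).
exists x; split=> // de f [fa ffin].
have [b ba bf] := finite_bounded a_pos a_lim ffin (fun i => @proj1 _ _).
have [k kE] : exists k, E k = (b, truncate b f).
  apply: Esurj; split=> //=; split; first exact: level_truncate (ltW ba) fa.
  rewrite differ_truncate; apply: finite_sub2 (@differ_tri _ _ _ _ x _) _ _.
    exact: sub_finite_set (differ_le (ltW ba)) ffin.
  exact: xcoh.
have [[ka _] _ _ bk /(_ de)] := sP k; rewrite kE /= in bk *.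
exists (s k.+1).1 => //; suff -> : truncate (s k.+1).1 f = graft b (truncate b f) (s k.+1).2 by [].
apply: funext => i; rewrite /truncate /graft; case: (ltP i b) => ib.
  by rewrite (lt_le_trans ib bk).
case: ltP => ik.
  rewrite -(xE k.+1)//; apply: contrapT => fx.
  have /bf : differ a f x i by split=> //; exact: lt_trans ka.
  by rewrite ltNge ib.
by have [_ [/level_eq0 ->]] := sN k.+1.
Qed.

End Generic.

(** Only a limit [a] needs the generic choice: the least [a] has only the zero function, and a
    successor extends the previous choice by one positive value. *)
Lemma good_ex a e G : (forall b, b < a -> good e (e b) b) ->
  exists x, good e x a /\
    ((exists b, b < a) -> (forall b, b < a -> exists2 c, b < c & c < a) ->
      dense [set b | b < a] e G -> branches_meet [set b | b < a] x a G).
Proof.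
move=> e_good.
have [[b0 b0a]|a0] := pselect (exists b, b < a); last first.
  have na i : (i < a) = false by apply/negP => ia; apply: a0; exists i.
  exists (fun=> 0); split=> [|/a0//]; split=> [i|n|b]; rewrite ?na//.
  by apply: sub_finite_set (finite_set0 _) => i [] /=; rewrite na.
have [lim|nlim] := pselect (forall b, b < a -> exists2 c, b < c & c < a).
  have [|x [gx mx]] := @generic_limit a e G _ lim e_good; first by exists b0.
  by exists x.
have /existsNP[b /not_implyP[ba nb]] := nlim.
have ltaE i : (i < a) = (i <= b).
  rewrite leNgt; apply/idP/negP => [ia bi|/negP]; first by apply: nb; exists i.
  by rewrite -leNgt => /le_lt_trans; apply.
(* The cast boolean is 1 at [b], the one new place below [a], and 0 beyond. *)
pose x i : rat := if i < b then e b i else (i == b)%:R.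
have [eb esm ecoh] := e_good b ba.
exists x; split=> //; split=> [i|n|c ca].
- rewrite ltaE /x; have [ib|bi|_] //= := ltgtP i b.
  exact: level_gt0 eb ib.
- apply: finite_sub2 _ (esm n) (finite_set1 b) => i []; rewrite ltaE le_eqVlt.
  by move=> /orP[/eqP->|ib]; [right|rewrite /x ib; left].
- rewrite ltaE in ca; apply: sub_finite_set (good_differ ca (e_good b ba)).
  by move=> i [ic]; rewrite /x (lt_le_trans ic ca).
Qed.

End Limit.

(** * The coherent family obtained from diamond *)

Section Diamond.
Context (d : Order.disp_t) (W : orderType d) (hW : is_omega1 W).
Implicit Types (a b c : W) (f g t u x : W -> rat) (e : W -> W -> rat)
  (D : set W) (G : W -> (W -> rat) -> Prop).

Lemma countable_bound_image (T : Type) (A : set T) (F : T -> W) : countable A ->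
  exists w, forall y, A y -> F y < w.
Proof.
move=> cA; have [|w wP] := @countable_bound _ _ hW (F @` A).
  exact: sub_countable (card_image_le _ _) cA.
by exists w => y Ay; apply: wP; exists y.
Qed.

(** Closed: a point of the set between [b] and the limit [a] bounds [Phi b]. Unbounded: iterate a
    map dominating [Phi] on initial segments and take the least strict bound of the iterates. *)
Lemma club_closure_points (Phi : W -> W) :
  is_club [set a | (exists b, b < a) /\ forall b, b < a -> Phi b < a].
Proof.
split=> [a|a [a_pos a_lim]]; last first.
  split=> // b /a_lim[c /andP[bc ca] [_ cP]].
  exact: lt_trans (cP _ bc) ca.
have next c : exists c', c < c' /\ forall b, b <= c -> Phi b < c'.
  have [s sP] := omega1_succ hW c.
  have [w wP] := countable_bound_image Phi (countable_below hW s).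
  have [w' [cw ww]] := omega1_bound2 hW c w.
  exists w'; split=> // b bc; apply: lt_trans ww; apply: wP.
  by rewrite /= sP.
have [F FP] := choice next.
pose s k := iter k F a.
have [w wP] := countable_bound_image s (countableP [set: nat]).
have [z zs zl] := @omega1_least _ _ hW [set z | forall k, s k < z]
  (ex_intro _ w (fun k => wP k I)).
exists z; first exact: (zs 0%N).
split=> [|b bz]; first by exists a; exact: (zs 0%N).
have [k bk] : exists k, b <= s k.
  apply: contrapT => /forallNP nb; have /zl : forall k, s k < b.
    by move=> k; rewrite ltNge; apply/negP.
  by rewrite leNgt bz.
by have [_ /(_ b bk)] := FP (s k); move/lt_trans; apply; exact: (zs k.+1).
Qed.

(** Diamond guesses subsets of [W], so the nodes, countably many at each level, are to be coded in
    [W]. Row [b] is an increasing sequence above all earlier rows, hence injectivity. *)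
Lemma omega1_pairing : exists j : W -> nat -> W,
  forall b b' k k', j b k = j b' k' -> b = b' /\ k = k'.
Proof.
have [_ ucW _] := hW.
have [w0 _] : [set: W] !=set0 by apply/set0P/eqP => W0; apply: ucW; rewrite W0.
pose R b (g : W -> nat -> W) (x : nat -> W) :=
  (forall k k', x k = x k' -> k = k') /\
  forall b', b' < b -> forall k k', g b' k' < x k.
have [||j jP] := @wf_choice W (nat -> W) (fun=> w0) _ R (omega1_wf hW).
- move=> b g.
  have [w wP] := @countable_bound_image (W * nat) ([set b' | b' < b] `*` [set: nat])
    (fun p => g p.1 p.2) (countableX (countable_below hW b) (countableP _)).
  have /choice[F FP] : forall v : W, exists v', v < v'.
    by move=> v; have [v' [? _]] := omega1_bound2 hW v v; exists v'.
  exists (fun k => iter k F w).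
  have mono k k' : (k < k')%N -> iter k F w < iter k' F w.
    elim: k' => // k' IH; rewrite ltnS leq_eqVlt => /orP[/eqP->|/IH kk] /=.
      exact: FP.
    exact: lt_trans (FP _).
  split=> [k k' kk|b' bb k k'].
    by case: (ltngtP k k') => // /mono; rewrite kk ltxx.
  apply: (@lt_le_trans _ _ w); first exact: (wP (b', k')).
  by case: k => // k; apply/ltW/(mono 0%N).
- move=> b g g' x gg [xi xP]; split=> // b' bb k k'.
  by rewrite -gg//; exact: xP.
exists j => b b' k k' jj; have [bi bP] := jP b; have [bi' bP'] := jP b'.
case: (ltgtP b b') => [bb|bb|bb].
- by have := bP' _ bb k' k; rewrite jj ltxx.
- by have := bP _ bb k k'; rewrite jj ltxx.
- by split=> //; subst b'; exact: bi.
Qed.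

Lemma good_local e e' x a : (forall b, b < a -> e b = e' b) ->
  good e x a -> good e' x a.
Proof. by move=> ee [? ? coh]; split=> // b ba; rewrite -ee//; exact: coh. Qed.

(** At a limit [a] the choice is generic for the set of nodes coded by [S a]. For a dense [B],
    diamond gives a closure point [a] of a suitable [Phi] at which [S a] codes [B] below [a], and
    genericity there applies to [B]. *)
Lemma coherent_family_ex (hdiamond : diamond W) :
  exists e, (forall a, good e (e a) a) /\
    forall G, dense [set: W] e G -> exists a, branches_meet [set b | b < a] (e a) a G.
Proof.
have [S [_ Sguess]] := hdiamond.
have [j jinj] := omega1_pairing.
have /choice[iota iotaP] : forall p : (W -> rat) * W, exists r : _ -> nat,
    {in [set f | node p.1 p.2 f] &, injective r}.
  by move=> p; exact/countable_injP/countable_node.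
(* [iota] numbers the nodes of level [b], and [j] turns this number into an element of [W]. Only
   [e b] is consulted, which keeps the recursion local. *)
pose guess a e b u := S a (j b (iota (e b, b) u)).
pose R a e x := (forall b, b < a -> good e (e b) b) -> good e x a /\
  ((exists b, b < a) -> (forall b, b < a -> exists2 c, b < c & c < a) ->
  dense [set b | b < a] e (guess a e) -> branches_meet [set b | b < a] x a (guess a e)).
have [||e eP] := @wf_choice W (W -> rat) (fun=> 0) _ R (omega1_wf hW).
- move=> a e; have [e_good|ne] := pselect (forall b, b < a -> good e (e b) b).
    have [x xP] := good_ex hW (guess a e) e_good.
    by exists x.
  by exists (fun=> 0).
- move=> a e e' x ee xP e_good.
  have [|gx mx] := xP.
    move=> b ba; rewrite ee//; apply: good_local (e_good b ba) => c cb.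
    by rewrite ee// (lt_trans cb).
  split; first exact: good_local gx.
  move=> a_pos a_lim de f fx; have [//|//||c ca] := mx _ _ _ f fx.
    move=> b t n /= ba; rewrite ee// => bt.
    have [c [u [bc ca cu Gu uext]]] := de b t n ba bt.
    by exists c, u; split=> //; rewrite ?/guess ee.
  by rewrite /guess ee// => Gc; exists c.
have e_good a : good e (e a) a.
  by elim/(well_founded_ind (omega1_wf hW)): a => a /eP[].
exists e; split=> // B dB.
pose X : set W := [set w | exists b u,
  [/\ node (e b) b u, B b u & w = j b (iota (e b, b) u)]].
have /choice[cf cfP] : forall p : W * (W -> rat) * nat, exists c,
    node (e p.1.1) p.1.1 p.1.2 ->
    exists u, [/\ p.1.1 <= c, node (e c) c u, B c u &
      extends p.2 p.1.1 p.1.2 c u].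
  move=> [[b t] n] /=; have [bt|nbt] := pselect (node (e b) b t).
    by have [c [u [? _ ? ? ?]]] := dB b t n I bt; exists c => _; exists u.
  by exists b.
(* A closure point of such a [Phi] has no last element below it, and bounds the codes of nodes of
   lower levels and the levels [cf] that witness density of [B] over them. *)
have Phi_ex b : exists w, [/\ b < w, forall k, j b k < w &
    forall t n, node (e b) b t -> cf (b, t, n) < w].
  have [w1 w1P] := countable_bound_image (j b) (countableP [set: nat]).
  have [w2 w2P] := @countable_bound_image _
    ([set t | node (e b) b t] `*` [set: nat]) (fun p => cf (b, p.1, p.2))
    (countableX (countable_node hW _ _) (countableP _)).
  have [w3 [bw w13]] := omega1_bound2 hW b w1.
  have [w [w3w w2w]] := omega1_bound2 hW w3 w2.
  exists w; split=> [|k|t n bt].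
  - exact: lt_trans w3w.
  - by apply: lt_trans (lt_trans w13 w3w); exact: w1P.
  - by apply: lt_trans w2w; exact: (w2P (t, n)).
have [Phi PhiP] := choice Phi_ex.
have [a [/= Xa [a_pos a_cl]]] := Sguess X _ (club_closure_points Phi).
have guessE b u : b < a -> node (e b) b u -> guess a e b u <-> B b u.
  move=> ba bu; rewrite /guess -Xa; split=> [[[b' [u' [bu' Bu' jE]]] _]|Bu].
    have [bE] := jinj _ _ _ _ jE; subst b' => /iotaP.
    by rewrite !inE/= => /(_ bu bu') ->.
  split; first by exists b, u.
  by have [_ /(_ (iota (e b, b) u)) jb _] := PhiP b; exact: lt_trans (a_cl b ba).
exists a => f fa; have [_ /(_ a_pos) h] := eP a (fun b _ => e_good b).
have [||c ca Gc] := h _ _ f fa; last 1 first.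
- exists c => //; apply/guessE => //.
  exact: node_truncate (ltW ca) (e_good a) fa.
- by move=> b ba; have [bP _ _] := PhiP b; exists (Phi b) => //; exact: a_cl.
- move=> b t n ba bt; have [u [bc cu Bu uext]] := cfP (b, t, n) bt.
  have ca : cf (b, t, n) < a.
    by have [_ _ /(_ t n bt)] := PhiP b; move/lt_trans; apply; exact: a_cl.
  by exists (cf (b, t, n)), u; split=> //; exact/guessE.
Qed.

End Diamond.

(** * The lexicographic order, and sorted lists of places *)

Section Lex.
Context (d : Order.disp_t) (W : orderType d) (hW : is_omega1 W).
Implicit Types (a b c : W) (f g h s t u : W -> rat) (e : W -> W -> rat).

Definition lex f g := exists2 i, (forall k, k < i -> f k = g k) & f i < g i.

Lemma lex_irr f : ~ lex f f.
Proof. by move=> [i _]; rewrite ltxx. Qed.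

Lemma lex_trans f g h : lex f g -> lex g h -> lex f h.
Proof.
move=> [i fg fgi] [j gh ghj]; case: (ltgtP i j) => [ij|ji|ij].
- exists i => [k ki|]; last by rewrite -gh.
  by rewrite fg// gh// (lt_trans ki).
- exists j => [k kj|]; last by rewrite fg.
  by rewrite fg ?gh// (lt_trans kj).
- subst j; exists i => [k ki|]; last exact: lt_trans ghj.
  by rewrite fg// gh.
Qed.

Lemma lex_total f g : f <> g -> lex f g \/ lex g f.
Proof.
move=> fg; have [|i fgi imin] := @omega1_least _ _ hW [set i | f i <> g i].
  apply: contrapT => no; apply: fg; apply: funext => i.
  by apply: contrapT => fgi; apply: no; exists i.
have eqi k : k < i -> f k = g k.
  by move=> ki; apply: contrapT => /imin; rewrite leNgt ki.
case: (ltgtP (f i) (g i)) => // lti; [left|right]; exists i => // k /eqi//.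
Qed.

Lemma lex_order_ex (P : set (W -> rat)) :
  exists (d' : Order.disp_t) (C : orderType d') (v : C -> W -> rat),
    [/\ forall x, P (v x), forall f, P f -> exists x, v x = f, injective v &
      forall x y, x < y <-> lex (v x) (v y)].
Proof.
pose C0 := {f : W -> rat | f \in P}.
pose lt0 : rel C0 := fun x y => `[< lex (val x) (val y) >].
pose le0 : rel C0 := fun x y => (x == y) || lt0 x y.
have irr : irreflexive lt0 by move=> x; apply/asboolP/lex_irr.
have trans : transitive lt0.
  by move=> y x z /asboolP xy /asboolP yz; apply/asboolP/(lex_trans xy).
have total x y : x != y -> lt0 x y || lt0 y x.
  move=> /eqP xy; have /lex_total[h|h] : val x <> val y by move=> /val_inj.
    by apply/orP; left; apply/asboolP.
  by apply/orP; right; apply/asboolP.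
pose mixin := @Order.LtOrder.Build Order.default_display C0 le0 lt0
  (fun x y => if lt0 x y then x else y) (fun x y => if lt0 x y then y else x)
  (fun _ _ => erefl) (fun _ _ => erefl) (fun _ _ => erefl) irr trans total.
pose C : orderType Order.default_display := HB.pack C0 mixin.
exists Order.default_display, C, (fun x : C0 => val x); split.
- by move=> x; have := valP x; rewrite inE.
- by move=> f Pf; exists (exist _ f (mem_set Pf)).
- exact: val_inj.
- by move=> x y; split=> [/asboolP//|?]; exact/asboolP.
Qed.

Definition coherent_tree e : set (W -> rat) := [set f | exists b, node (e b) b f].

Lemma filter_lt_sorted (y z : W) (q : seq W) : sorted <%O q -> y \in q ->
  nth z q (size [seq i <- q | i < y]) = y.
Proof.
elim: q => // w q IH /= /[dup] /path_sorted sq wq.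
have wall : all (fun i => w < i) q := order_path_min lt_trans wq.
rewrite inE => /orP[/eqP ->|yq].
  rewrite ltxx (_ : [seq _ <- q | _] = [::])//.
  apply/eqP; rewrite -size_eq0 size_filter -leqn0 leqNgt -has_count.
  by apply/hasPn => i /(allP wall); rewrite /= -leNgt => /ltW.
by rewrite (allP wall)//=; exact: IH.
Qed.

(** The two lists have the same entries below [y], so [y] has the same rank in both, and equal lists
    of values agree at that rank. *)
Lemma sorted_map_eq (X : Type) (y : W) (q q' : seq W) (g g' : W -> X) :
  sorted <%O q -> sorted <%O q' -> y \in q -> y \in q' ->
  (forall i, i < y -> (i \in q) = (i \in q')) ->
  [seq g i | i <- q] = [seq g' i | i <- q'] -> g y = g' y.
Proof.
move=> sq sq' yq yq' qq' gg.
have E : [seq i <- q | i < y] = [seq i <- q' | i < y].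
  apply: lt_sorted_eq; rewrite ?lt_sorted_filter// => i.
  by rewrite !mem_filter; case: ltP => //= /qq'.
have k1 : (size [seq i <- q | (i < y)%O] < size q)%N.
  rewrite size_filter -(count_predC (fun i : W => i < y) q) -[ltnLHS]addn0 ltn_add2l.
  by rewrite -has_count; apply/hasP; exists y; rewrite //= ltxx.
have k2 : (size [seq i <- q | (i < y)%O] < size q')%N.
  by rewrite -(size_map g') -gg size_map.
have := congr1 (fun l => nth (g y) l (size [seq i <- q | i < y])) gg.
rewrite (nth_map y)// (nth_map y)// filter_lt_sorted//.
by rewrite {1}E filter_lt_sorted.
Qed.

Lemma finite_rat_bound (S : set W) f : finite_set S ->
  exists n : nat, forall i, S i -> f i < n%:R.
Proof.
move=> /finite_seqP[q ->]; elim: q => [|j q [n IH]]; first by exists 0%N.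
exists (maxn n (Num.bound (f j))) => i; rewrite /= inE.
have le (k m : nat) : (k <= m)%N -> (k%:R : rat) <= m%:R by rewrite ler_nat.
move=> /orP[/eqP->|/IH/lt_le_trans]; last by apply; apply/le/leq_maxl.
have [f0|f0] := leP 0 (f j); last exact: lt_le_trans f0 (ler0n _ _).
by apply: lt_le_trans (archi_boundP f0) _; apply/le/leq_maxr.
Qed.

End Lex.

(** * Colouring of pairs of nodes *)

Section Tree.
Context (d : Order.disp_t) (W : orderType d) (hW : is_omega1 W).
Context (e : W -> W -> rat) (e_good : forall a, good e (e a) a).
Implicit Types (a b c : W) (f g h s t u : W -> rat) (A : set (W -> rat)).

(** The data behind the colour of a pair. By the last clause, both values are below [n] at the
    places in [q], and the two nodes agree at all other places up to [m]. *)
Definition coded s t (m : W) (n : nat) (q : seq W) :=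
  [/\ s m = 0 \/ t m = 0, sorted <%O q,
    [set` q] = [set i | i <= m /\ (s i < n%:R \/ t i < n%:R)] &
    forall i, i <= m -> s i < n%:R /\ t i < n%:R \/ s i = t i /\ n%:R <= s i].

(** For [m] the first zero, the places below [m] are below both levels, so coherence leaves finitely
    many differences. Take [n] above the values there; each node is below [n] only finitely
    often. *)
Lemma coded_ex s t : coherent_tree e s -> coherent_tree e t ->
  exists m n q, coded s t m n q.
Proof.
move=> [b bs] [c ct].
have [|m m0 mmin] := @omega1_least _ _ hW [set i | s i = 0 \/ t i = 0].
  by exists b; left; have [/level_eq0 -> ] := bs.
have posm i : i < m -> 0 < s i /\ 0 < t i.
  move=> im; rewrite !lt0r (level_ge0 _ (proj1 bs)) (level_ge0 _ (proj1 ct)) !andbT.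
  by split; apply/eqP => z; have : m <= i by [apply: mmin; left|apply: mmin; right];
    rewrite leNgt im.
have sb i : i < m -> i < b by move=> /posm[si _]; rewrite -(level_ltE _ (proj1 bs)).
have tc i : i < m -> i < c by move=> /posm[_ ti]; rewrite -(level_ltE _ (proj1 ct)).
have fD : finite_set ([set i | i <= m /\ s i <> t i] `|` [set m]).
  rewrite finite_setU; split; last exact: finite_set1.
  have [bc|/ltW cb] := leP b c.
    apply: finite_sub2 _ (node_differ bc (e_good c) bs ct) (finite_set1 m) => i [].
    by rewrite le_eqVlt => /orP[/eqP->|/sb ib] si; [right|left].
  apply: finite_sub2 _ (node_differ cb (e_good b) ct bs) (finite_set1 m) => i [].
  rewrite le_eqVlt => /orP[/eqP->|/tc ib] si; [by right|left].
  by split=> // E; apply: si.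
have [n1 n1P] := finite_rat_bound s fD.
have [n2 n2P] := finite_rat_bound t fD.
pose n := (maxn n1 n2).
have sn i : ([set i | i <= m /\ s i <> t i] `|` [set m]) i -> s i < n%:R.
  by move=> /n1P/lt_le_trans; apply; rewrite ler_nat leq_maxl.
have tn i : ([set i | i <= m /\ s i <> t i] `|` [set m]) i -> t i < n%:R.
  by move=> /n2P/lt_le_trans; apply; rewrite ler_nat leq_maxr.
have : finite_set [set i | i <= m /\ (s i < n%:R \/ t i < n%:R)].
  have fS := node_small n (e_good b) bs; have fT := node_small n (e_good c) ct.
  have fST : finite_set (small b s n `|` [set m]) by rewrite finite_setU.
  apply: finite_sub2 _ fST fT => i []; rewrite le_eqVlt => /orP[/eqP->|im] h.
    by left; right.
  by case: h => h; [left; left; split=> //; exact: sb|right; split=> //; exact: tc].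
move=> /finite_seqP[q0 q0E].
exists m, n, (sort <=%O (undup q0)); split=> //.
- by rewrite sort_lt_sorted undup_uniq.
- by rewrite q0E; apply/seteqP; split=> i; rewrite /= mem_sort mem_undup.
- move=> i im; have [E|N] := eqVneq (s i) (t i); last first.
    by left; split; [apply: sn|apply: tn]; left; split=> //; exact/eqP.
  by rewrite -E; have [?|?] := leP n%:R (s i); [right|left].
Qed.

(** A node vanishes from its first zero on, so both functions are 0 beyond [m]. *)
Lemma zero_determines s s' m i : coherent_tree e s -> coherent_tree e s' ->
  (forall k, k <= m -> s k = s' k) -> s m = 0 -> s i = s' i.
Proof.
move=> [b [bs _]] [b' [bs' _]] ss sm; have [/ss//|mi] := leP i m.
have zero c f : level c f -> f m = 0 -> f i = 0.
  move=> cf fm; apply: (level_eq0 cf); apply: le_trans (ltW mi).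
  by rewrite leNgt -(level_ltE _ cf) fm ltxx.
by rewrite (zero b)// (zero b')// -ss.
Qed.

(** Otherwise let [k] be the first place where [s, s'] or [t, t'] differ, so that [s k <= s' k] and
    [t' k <= t k], not both equalities. If [k] is in both lists, the colour gives equalities; if in
    neither, [t' k <= t k = s k <= s' k = t' k]; if in just one, a value below [n] bounds a value at
    least [n]. *)
Lemma coded_lex s t s' t' m m' n q q' :
  coherent_tree e s -> coherent_tree e t ->
  coherent_tree e s' -> coherent_tree e t' ->
  coded s t m n q -> coded s' t' m' n q' ->
  [seq (s i, t i) | i <- q] = [seq (s' i, t' i) | i <- q'] ->
  lex s s' -> ~ lex t' t.
Proof.
move=> Ts Tt Ts' Tt' [z sq qE alt] [z' sq' qE' alt'] st [i ssi lts] [j ttj ltt].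
pose k := Order.min i j.
have ss l : l < k -> s l = s' l by rewrite lt_min => /andP[/ssi].
have tt l : l < k -> t l = t' l by rewrite lt_min => /andP[_ /ttj].
have sk : s k <= s' k.
  have : k <= i by rewrite ge_min lexx.
  by rewrite le_eqVlt => /orP[/eqP->|/ssi->//]; exact: ltW.
have tk : t' k <= t k.
  have : k <= j by rewrite ge_min lexx orbT.
  by rewrite le_eqVlt => /orP[/eqP->|/ttj->//]; exact: ltW.
have neq : s k = s' k -> t k = t' k -> False.
  rewrite /k; case: ltP => ij E1 E2; first by move: lts; rewrite E1 ltxx.
  by move: ltt; rewrite E2 ltxx.
(* If [m < k], the node of the pair [s, t] that vanishes at [m] equals its counterpart, contrary to
   the choice of [i] or [j]. *)
have km : k <= m.
  rewrite leNgt; apply/negP => mk; have lk l : l <= m -> l < k by move/le_lt_trans; apply.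
  case: z => z.
    by move: lts; rewrite (zero_determines i Ts Ts' (fun l lm => ss l (lk l lm)) z) ltxx.
  by move: ltt; rewrite (zero_determines j Tt Tt' (fun l lm => tt l (lk l lm)) z) ltxx.
have km' : k <= m'.
  rewrite leNgt; apply/negP => mk; have lk l : l <= m' -> l < k by move/le_lt_trans; apply.
  case: z' => z'.
    by move: lts; rewrite -(zero_determines i Ts' Ts (fun l lm => esym (ss l (lk l lm))) z') ltxx.
  by move: ltt; rewrite -(zero_determines j Tt' Tt (fun l lm => esym (tt l (lk l lm))) z') ltxx.
have qP l : l \in q <-> l <= m /\ (s l < n%:R \/ t l < n%:R).
  by have := congr1 (fun S : set W => S l) qE => /= ->.
have qP' l : l \in q' <-> l <= m' /\ (s' l < n%:R \/ t' l < n%:R).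
  by have := congr1 (fun S : set W => S l) qE' => /= ->.
have [[sn tn]|[st1 sn]] := alt k km; have [[sn' tn']|[st1' sn']] := alt' k km'.
- have [] : (s k, t k) = (s' k, t' k).
    apply: (@sorted_map_eq _ _ _ k q q') st => //.
    + by apply/qP; split=> //; left.
    + by apply/qP'; split=> //; left.
    + move=> l lk; apply/idP/idP => [/qP|/qP'] [_ h]; [apply/qP'|apply/qP].
        by rewrite -ss// -tt//; split=> //; exact: ltW (lt_le_trans lk km').
      by rewrite ss// tt//; split=> //; exact: ltW (lt_le_trans lk km).
  exact: neq.
- by have := le_lt_trans tk tn; rewrite -st1' ltNge sn'.
- by have := le_lt_trans (le_trans sn sk) sn'; rewrite ltxx.
- have ssk : s k = s' k.
    by apply/eqP; rewrite eq_le sk st1' st1 tk.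
  by apply: (neq ssk); rewrite -st1 -st1'.
Qed.

(** The colour keeps [n] and the listed values but neither [m] nor the places in [q], so that it can
    be coded in [nat]. *)
Lemma color_ex : exists color : (W -> rat) * (W -> rat) -> nat,
  forall s t s' t', coherent_tree e s -> coherent_tree e t ->
  coherent_tree e s' -> coherent_tree e t' ->
  color (s, t) = color (s', t') -> lex s s' -> ~ lex t' t.
Proof.
have /choice[code codeP] : forall p : (W -> rat) * (W -> rat),
    exists r : W * nat * seq W,
    coherent_tree e p.1 -> coherent_tree e p.2 -> coded p.1 p.2 r.1.1 r.1.2 r.2.
  move=> [s t] /=.
  have [[Ts Tt]|no] := pselect (coherent_tree e s /\ coherent_tree e t).
    by have [m [n [q ?]]] := coded_ex Ts Tt; exists (m, n, q).
  have [m _] : exists m : W, True.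
    by have [_ ucW _] := hW; have [m _] : [set: W] !=set0 by
      apply/set0P/eqP => W0; apply: ucW; rewrite W0.
  by exists (m, 0%N, [::]) => Ts Tt; case: no.
exists (fun p => pickle ((code p).1.2, [seq (p.1 i, p.2 i) | i <- (code p).2])).
move=> s t s' t' Ts Tt Ts' Tt' /(pcan_inj pickleK)[nE qE].
apply: coded_lex qE => //; first exact: (codeP (s, t)).
by rewrite nE; exact: (codeP (s', t')).
Qed.

Lemma coherent_tree_uncountable : ~ countable (coherent_tree e).
Proof.
have [_ ucW _] := hW; move=> cT; apply: ucW.
have /countable_injP[r rinj] := cT.
have Te b : coherent_tree e (e b) by exists b; exact: node_self.
apply/countable_injP; exists (fun b => r (e b)) => b c _ _ /rinj.
rewrite !inE => /(_ (Te b) (Te c)) ebc.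
have [lb _ _] := e_good b; have [lc _ _] := e_good c.
case: (ltgtP b c) => // bc.
  by have := level_gt0 lc bc; rewrite -ebc (level_eq0 lb)// ltxx.
by have := level_gt0 lb bc; rewrite ebc (level_eq0 lc)// ltxx.
Qed.

(** * Embedding of the tree into its uncountable subsets *)

Lemma countable_nodes_below a :
  countable (\bigcup_(b in [set b | b < a]) [set f | node (e b) b f]).
Proof.
by apply: bigcup_countable => [|b _]; [exact: countable_below|exact: countable_node].
Qed.

Hypothesis e_meet : forall G, dense [set: W] e G ->
  exists a, branches_meet [set b | b < a] (e a) a G.

(** Otherwise the set [B] of nodes without extension in [A] is dense, and for some [a] every node of
    level [a] has a truncation in [B]. So all members of [A] have level below [a], and [A] is
    countable. *)
Lemma frozen_cone A : A `<=` coherent_tree e -> ~ countable A ->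
  exists b t n, [/\ (0 < n)%N, node (e b) b t & forall c u, b <= c ->
    node (e c) c u -> extends n b t c u -> exists2 v, A v & truncate c v = u].
Proof.
move=> AT ucA; apply: contrapT => no.
pose B c u := ~ exists2 v, A v & truncate c v = u.
have [|a aP] := e_meet (G := B).
  (* Using [n.+1] secures [0 < n] in the conclusion, which later keeps the values of the embedded
     nodes positive. *)
  move=> b t n _ bt; apply: contrapT => h; apply: no; exists b, t, n.+1; split=> //.
  move=> c u bc cu [ut un]; apply: contrapT => nAu; apply: h; exists c, u; split=> //.
  by split=> // i bi ic; apply: le_trans (un i bi ic); rewrite ler_nat.
apply: ucA; apply: sub_countable (countable_nodes_below a).
apply: subset_card_le => v Av; have [b bv] := AT v Av.
have [ba|ab] := ltP b a; first by exists b.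
have [c /= ca] := aP _ (node_truncate ab (e_good b) bv).
by rewrite truncate_truncate ?(ltW ca)// => -[]; exists v.
Qed.

(** The maximum of two increasing lines meeting at [n + 1]: one is at least [n] for [x >= 0], and
    the other, the identity, takes over from [n + 1] on. *)
Let phi (n : nat) (x : rat) := Num.max x (n%:R + x / n.+1%:R).

Let phi_lt n x y : x < y -> phi n x < phi n y.
Proof.
move=> xy; rewrite /phi gt_max !lt_max xy /=; apply/orP; right.
by rewrite ltrD2l ltr_pM2r// invr_gt0 ltr0n.
Qed.

Let phi_ge n x : 0 <= x -> n%:R <= phi n x.
Proof.
by move=> x0; rewrite /phi le_max; apply/orP; right; rewrite lerDl divr_ge0.
Qed.

Let phi_id n x : n.+1%:R <= x -> phi n x = x.
Proof.
move=> nx; apply/max_idPl.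
have n0 : (0 : rat) < n.+1%:R by rewrite ltr0n.
rewrite -(ler_pM2r n0) mulrDl divfK ?gt_eqF//.
have -> : (n.+1%:R : rat) = n%:R + 1 by rewrite -natr1.
rewrite -natr1 in nx; have : (0 : rat) <= n%:R by []. nra.
Qed.

(** The truncations at [b] are countably many, so numbering them turns [lex] into a strict partial
    order on [nat], which maps into any rational interval. *)
Lemma head_embedding b (lo hi : rat) : lo < hi -> exists psi : (W -> rat) -> rat,
  (forall u, lo < psi u < hi) /\ forall u v,
  coherent_tree e u -> coherent_tree e v ->
  lex (truncate b u) (truncate b v) -> psi (truncate b u) < psi (truncate b v).
Proof.
move=> lohi; pose H : set (W -> rat) := [set truncate b u | u in coherent_tree e].
have [b' b'P] := omega1_succ hW b.
have /countable_injP[r rinj] : countable H.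
  apply: sub_countable (countable_nodes_below b').
  apply: subset_card_le => _ [u [c cu] <-]; have [bc|/ltW cb] := leP b c.
    by exists b; [rewrite /= b'P|exact: node_truncate bc (e_good c) cu].
  exists c; first by rewrite /= b'P.
  suff -> : truncate b u = u by [].
  apply: funext => i; rewrite /truncate /graft; case: (ltP i b) => // bi.
  by rewrite (level_eq0 (proj1 cu))// (le_trans cb).
pose R k l := exists u v, [/\ H u, H v, r u = k, r v = l & lex u v].
have rI u v : H u -> H v -> r u = r v -> u = v.
  by move=> Hu Hv; apply: rinj; rewrite inE.
have [||q [qb qR]] := @partial_order_rat R lo hi lohi.
- move=> k [u [v [Hu Hv uk vk]]]; rewrite (rI u v)// ?uk//; exact: lex_irr.
- move=> k l m [u [v [Hu Hv uk vk uv]]] [u' [v' [Hu' Hv' uk' vk' uv']]].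
  exists u, v'; split=> //; apply: lex_trans uv _.
  by rewrite (rI v u')// vk uk'.
exists (fun u => q (r u)); split=> [u|u v Tu Tv uv]; first exact: qb.
apply: qR; exists (truncate b u), (truncate b v).
by split=> //; [exists u|exists v].
Qed.

Lemma tree_embedding A : A `<=` coherent_tree e -> ~ countable A ->
  exists h : (W -> rat) -> W -> rat, forall u, coherent_tree e u -> A (h u) /\
    forall v, coherent_tree e v -> lex u v -> lex (h u) (h v).
Proof.
move=> AT ucA; have [b [t [n [n0 bt frozen]]]] := frozen_cone AT ucA.
(* Place [b] will carry the code, so the value of [u] at [b] must be coded too: the truncation is at
   [b'], not at [b]. *)
have [b' b'P] := omega1_succ hW b.
have [|psi [psib psiL]] := @head_embedding b' n%:R n.+1%:R; first by rewrite ltr_nat.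
pose h0 u i := if i < b then t i else if i == b then psi (truncate b' u)
  else phi n (u i).
have /choice[zh zhP] : forall u, exists p : W * (W -> rat), coherent_tree e u ->
    [/\ A p.2, b < p.1, forall c, level c u -> c < p.1 &
      forall i, i < p.1 -> p.2 i = h0 u i].
  move=> u; have [[c cu]|nu] := pselect (coherent_tree e u); last by exists (b, u).
  (* The cut exceeds the level [c] of [u]: at place [c], [u] is 0 while a proper extension of [u] is
     positive, and the images must differ there too. *)
  have [z zP] := omega1_succ hW (Order.max b' c).
  have bb' : b < b' by rewrite b'P.
  have bz : b < z by rewrite zP le_max (ltW bb').
  have cz : c < z by rewrite zP le_max lexx orbT.
  pose hz i := if i < z then h0 u i else 0.
  have hz_ge i : b <= i -> i < z -> n%:R <= hz i.
    move=> bi iz; rewrite /hz iz /h0 ltNge bi /=; case: eqP => _.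
      by apply: ltW; case/andP: (psib (truncate b' u)).
    by apply: phi_ge; exact: level_ge0 (proj1 cu).
  have node_hz : node (e z) z hz.
    split=> [i|].
      have [iz|zi] := ltP i z; last by rewrite /hz ltNge zi.
      have [ib|bi] := ltP i b; first by rewrite /hz iz /h0 ib (level_gt0 (proj1 bt)).
      by apply: lt_le_trans (hz_ge i bi iz); rewrite ltr0n.
    have zz := node_self (e_good z).
    have f1 : finite_set (differ b t (e z) `|` [set b]).
      rewrite finite_setU; split; last exact: finite_set1.
      exact: node_differ (ltW bz) (e_good z) bt zz.
    have f2 : finite_set (small c u n.+1 `|` [set Order.max b' c]).
      rewrite finite_setU; split; last exact: finite_set1.
      exact: node_small (e_good c) cu.
    have f3 : finite_set (differ c u (e z)).
      exact: node_differ (ltW cz) (e_good z) cu zz.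
    have f23 : finite_set ((small c u n.+1 `|` [set Order.max b' c]) `|`
      differ c u (e z)) by rewrite finite_setU.
    apply: finite_sub2 _ f1 f23 => i [iz]; rewrite /hz iz /h0.
    case: (ltgtP i b) => [ib|bi|->] //= ne; [by left; left| |by left; right].
    (* Above [b] and apart from the top place, [hz] differs from [e z] only where [u] is below
       [n + 1] or already differs from [e z]. *)
    right; have ic : i != Order.max b' c -> i < c.
      move=> im; have : i < Order.max b' c by rewrite lt_neqAle im -zP.
      by rewrite lt_max b'P leNgt bi.
    have [->|/ic {}ic] := eqVneq i (Order.max b' c); first by left; right.
    have [un|nu] := ltP (u i) n.+1%:R; first by left; left.
    by right; split=> //; rewrite -(phi_id nu).
  have [|v Av vE] := frozen z hz (ltW bz) node_hz.
    by split=> // i ib; rewrite /hz (lt_trans ib bz) /h0 ib.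
  exists (z, v) => _; split=> //= [c' c'u|i iz]; last first.
    have := congr1 (fun f => f i) vE.
    by rewrite /truncate /graft /hz iz.
  rewrite ltNge; apply/negP => zc'.
  have := level_gt0 c'u (lt_le_trans cz zc').
  by rewrite (level_eq0 (proj1 cu))// ltxx.
exists (fun u => (zh u).2) => u Tu; have [Au bu zu hu] := zhP u Tu.
split=> // v Tv [i uvi lti]; have [_ bv zv hv] := zhP v Tv.
(* A first difference up to [b] shows at [b] through [psi]; a later one stays in place under
   [phi n]. *)
have [ib|bi] := leP i b.
  exists b => [k kb|]; first by rewrite hu ?hv ?(lt_trans kb)// /h0 kb.
  rewrite hu// hv// /h0 ltxx eqxx; apply: psiL => //.
  exists i; rewrite /truncate /graft ?b'P ?ib// => k ki.
  by rewrite b'P (le_trans (ltW ki) ib) uvi.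
have [c [cu _]] := Tu; have [c' [cv _]] := Tv.
have ic' : i < c'.
  by rewrite -(level_ltE _ cv); apply: le_lt_trans lti; exact: level_ge0 cu.
have ic : i <= c.
  rewrite leNgt; apply/negP => ci; have := level_gt0 cv (lt_trans ci ic').
  by rewrite -uvi// (level_eq0 cu)// ltxx.
have iu : i < (zh u).1 := le_lt_trans ic (zu c cu).
have iv : i < (zh v).1 := lt_trans ic' (zv c' cv).
have tE : truncate b' u = truncate b' v.
  apply: funext => k; rewrite /truncate /graft; case: ltP => //.
  by rewrite b'P => kb; apply: uvi; exact: le_lt_trans bi.
exists i => [k ki|].
  by rewrite hu ?hv ?(lt_trans ki)// /h0 tE uvi.
by rewrite hu// hv// /h0 ltNge (ltW bi) gt_eqF//=; exact: phi_lt.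
Qed.

End Tree.

(** * The tree as a Countryman line *)

Theorem theorem1p16 (d : Order.disp_t) (W : orderType d)
    (hW : is_omega1 W) (hdiamond : diamond W) :
  exists (d' : Order.disp_t) (C : orderType d'),
    is_countryman C /\
    (forall A : set C, ~ countable A -> embeds_into_suborder A).
Proof.
have [e [e_good e_meet]] := coherent_family_ex hW hdiamond.
have [d' [C [v [vT vsurj vinj vlex]]]] := lex_order_ex hW (coherent_tree e).
exists d', C; split; [split|].
- move=> cC; apply: (coherent_tree_uncountable hW e_good).
  apply: sub_countable (sub_countable (card_image_le v _) cC).
  by apply: subset_card_le => f /vsurj[p <-]; exists p.
- have [color colorP] := color_ex hW e_good.
  exists (fun n => [set p | color (v p.1, v p.2) = n]); split; last first.
    by apply/seteqP; split=> // p _; exists (color (v p.1, v p.2)).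
  move=> n [p1 p2] [q1 q2] /= pn qn; rewrite !leEprod /=.
  (* Within a colour class the two coordinates never move in strictly opposite directions. *)
  have anti (x1 x2 y1 y2 : C) : color (v x1, v x2) = color (v y1, v y2) ->
      x1 < y1 -> x2 <= y2.
    move=> xy /vlex xy1; rewrite leNgt; apply/negP => /vlex.
    by apply: colorP xy xy1.
  case: (ltgtP p1 q1) => [pq|qp|_] /=.
  + by left; apply: anti pq; rewrite pn.
  + by right; apply: anti qp; rewrite pn.
  + by apply/orP; exact: le_total.
- move=> A ucA.
  have [||h hP] := tree_embedding hW e_good e_meet (A := v @` A).
  + by move=> _ [x _ <-].
  + move=> cA; apply: ucA; have /countable_injP[r rinj] := cA.
    apply/countable_injP; exists (fun x => r (v x)) => x y.
    rewrite !inE => Ax Ay /rinj; rewrite !inE => vxy; apply: vinj.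
    by apply: vxy; [exists x|exists y].
  have /choice[f fP] : forall x, exists y, A y /\ v y = h (v x).
    by move=> x; have [[y Ay yE] _] := hP _ (vT x); exists y.
  exists f; split=> [x|]; first by have [] := fP x.
  apply: le_mono => x y /vlex xy; apply/vlex.
  have [_ ->] := fP x; have [_ ->] := fP y.
  by have [_] := hP _ (vT x); apply.
Qed.
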